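(* The original system $$(\mathrm{O})\quad\begin{cases}K_R\dot{\boldsymbol{\Psi}}+(K_L+\Gamma(\theta))\boldsymbol{\Psi}=f(t),\\ J\ddot{\boldsymbol{\theta}}+D\dot{\boldsymbol{\theta}}+K\boldsymbol{\theta}+\frac12\boldsymbol{\Psi}^\top\frac{d\Gamma(\theta)}{d\theta}\boldsymbol{\Psi}=T\end{cases}$$ is equivalent to the reductive system $$(\mathrm{R})\quad\begin{cases}\widetilde K_R\dot{\widetilde{\boldsymbol{\Psi}}}+\widetilde N(\theta)\widetilde{\boldsymbol{\Psi}}=\widetilde f(t),\\ J\ddot{\boldsymbol{\theta}}+D\dot{\boldsymbol{\theta}}+K\boldsymbol{\theta}+\frac12\widetilde{\boldsymbol{\Psi}}^\top\frac{d\widetilde N(\theta)}{d\theta}\widetilde{\boldsymbol{\Psi}}=T\end{cases}$$ That is to say: (1) If $(\boldsymbol{\Psi},\boldsymbol{\theta})$ solves $(\mathrm{O})$, then $\big(\widetilde{\boldsymbol{\Psi}}:=(\Psi_k:k\in\Lambda_2)^\top,\ \boldsymbol{\theta}\big)$ solves $(\mathrm{R})$. (2) Conversely, if $(\widetilde{\boldsymbol{\Psi}},\boldsymbol{\theta})$ solves $(\mathrm{R})$, then $\big(\boldsymbol{\Psi}(t):=A(\theta(t))\widetilde{\boldsymbol{\Psi}}(t),\ \boldsymbol{\theta}\big)$ solves $(\mathrm{O})$ for the function $$A(\theta)=\begin{pmatrix}-N_{\Lambda_1,\Lambda_1}^{-1}(\theta)\,N_{\Lambda_1,\Lambda_2}(\theta)\\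 I_{|\Lambda_2|}\end{pmatrix}.$$
   Context: Circuit data. Let $n$ be the number of nodes of an electric circuit connected to a 7-winding generator, the $n$-th node being connected directly to the generator. For $1\le i<j\le n$ let $\ell_{ij}=\ell_{ji}\in(0,+\infty]$ be the inductance linking nodes $i$ and $j$, where $\ell_{ij}=+\infty$ means that they are not connected, with $\ell_{ij}^{-1}=0$ in that case. Let $r_1\in(0,+\infty)$, $r_i\in(0,+\infty]$ for $2\le i\le n$ (with $r_i^{-1}=0$ if $r_i=+\infty$), and $r_f,r_D,r_g,r_Q\in(0,+\infty)$ be resistances. Unknowns. $\boldsymbol{\Psi}=(\Psi_{1\alpha},\Psi_{1\beta},\dots,\Psi_{n\alpha},\Psi_{n\beta},\Psi_f,\Psi_D,\Psi_g,\Psi_Q)^\top\in\mathbb{R}^{2n+4}$ and $\boldsymbol{\theta}=(\theta_1,\dots,\theta_6)^\top\in\mathbb{R}^6$ are functions of time $t$, and $\theta:=\theta_5$. Coordinates of $\boldsymbol{\Psi}$ are numbered $1,\dots,2n+4$ in this order, so node $i$ corresponds to coordinates $2i-1,2i$. Coefficients. $$K_R=\mathrm{diag}(r_1^{-1},r_1^{-1},\dots,r_n^{-1},r_n^{-1},r_f^{-1},r_D^{-1},r_g^{-1},r_Q^{-1})\in\mathbb{R}^{(2n+4)\times(2n+4)},$$ $J=\mathrm{diag}(J_1,\dots,J_6)$, $D=0$, $T=(T_1,T_2,T_3,T_4,0,0)^\top$, and $K\in\mathbb{R}^{6\times6}$ is the symmetric tridiagonal matrix with diagonal $(K_1,K_1+K_2,K_2+K_3,K_3+K_4,K_4+K_5,K_5)$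 and off-diagonal entries $-K_1,-K_2,-K_3,-K_4,-K_5$; all $J_i,T_i,K_i$ are constants. $K_L=\begin{pmatrix}L&0\\0&0\end{pmatrix}\in\mathbb{R}^{(2n+4)\times(2n+4)}$, where $L\in\mathbb{R}^{2n\times2n}$, with rows and columns indexed by $1\alpha,1\beta,\dots,n\alpha,n\beta$, has for $1\le i,j\le n$ the entries $L_{i\alpha,j\beta}=L_{i\beta,j\alpha}=0$ and $L_{i\alpha,j\alpha}=L_{i\beta,j\beta}$ equal to $\sum_{k\ne i}\ell_{ik}^{-1}$ if $i=j$ and to $-\ell_{ij}^{-1}$ if $i\ne j$. $$f(t)=\Big(\tfrac{U_s}{r_1}\cos(\omega_st),\tfrac{U_s}{r_1}\cos(\omega_st),0,\dots,0,\tfrac{U_f}{r_f},0,0,0\Big)^\top\in\mathbb{R}^{2n+4},$$ with $\omega_s=120\pi$ and given constants $U_s,U_f>0$ (the entry $U_f/r_f$ is in coordinate $2n+1$). $$\Gamma(\theta)=\begin{pmatrix}0&0\\0&P(\theta)\Gamma_0P(-\theta)\end{pmatrix}\in\mathbb{R}^{(2n+4)\times(2n+4)},\qquad P(\theta)=\begin{pmatrix}\cos\theta&-\sin\theta&0\\ \sin\theta&\cos\theta&0\\0&0&I_4\end{pmatrix}\in\mathbb{R}^{6\times 6},$$ where $\Gamma_0\in\mathbb{R}^{6\times6}$ is a given constant (symmetric) positive definite matrix. Put $N(\theta):=K_L+\Gamma(\theta)$. Abbreviation: in the second (vector) equations, $\boldsymbol{\Psi}^\top\frac{d\Gamma(\theta)}{d\theta}\boldsymbol{\Psi}$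 denotes the vector $\big(0,0,0,0,\boldsymbol{\Psi}^\top\frac{d\Gamma(\theta)}{d\theta}\boldsymbol{\Psi},0\big)^\top\in\mathbb{R}^6$ with the scalar in the fifth component, and similarly for $\widetilde{\boldsymbol{\Psi}}^\top\frac{d\widetilde N(\theta)}{d\theta}\widetilde{\boldsymbol{\Psi}}$. Reduction. Let $$\Lambda_1:=\{2i-1,2i:\ r_i=+\infty,\ 1\le i\le n\},\qquad \Lambda_2:=\{1,\dots,2n+4\}\setminus\Lambda_1.$$ $N_{\Lambda_i,\Lambda_j}:=(N_{k,\ell})_{k\in\Lambda_i,\ell\in\Lambda_j}$ is the submatrix of $N=N(\theta)$ consisting of the rows in $\Lambda_i$ and the columns in $\Lambda_j$, and $|\Lambda_2|$ is the cardinality of $\Lambda_2$. Without loss of generality, by re-numbering the nodes, the coordinates in $\Lambda_1$ are listed before those in $\Lambda_2$ (i.e. $\Lambda_1=\{1,\dots,m\}$, $\Lambda_2=\{m+1,\dots,2n+4\}$ after re-numbering), all vectors and matrices being re-ordered accordingly. Define $$\widetilde K_R:=\mathrm{diag}\big((K_R)_{k,k}:k\in\Lambda_2\big),\qquad \widetilde f(t):=(f_k(t):k\in\Lambda_2)^\top,\qquad \widetilde N(\theta):=A^\top(\theta)N(\theta)A(\theta),$$ with $A(\theta)$ the matrix displayed in part (2).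
   Formalization: Added hypothesis: every node with infinite resistance is joined through finite inductances to a node of finite resistance or to node n; this is exactly the condition for the inverse of N restricted to Λ1 to exist, and without it A and the reduced system are undefined. *)

(* Defs.v *)
From HB Require Import structures.
From mathcomp Require Import all_boot all_order all_algebra.
From mathcomp Require Import all_classical all_reals all_analysis.

Set Implicit Arguments.
Unset Strict Implicit.
Unset Printing Implicit Defensive.

Import Order.TTheory GRing.Theory Num.Theory.
Import numFieldTopology.Exports numFieldNormedType.Exports.

Local Open Scope ring_scope.

(* A circuit has n.+1 nodes, indexed from 0 by 'I_n.+1: node ord0 carries the  *)
(* voltage source and node ord_max is connected directly to the generator.     *)
(* Coordinates are also 0-based: 2i and 2i+1 are the alpha and beta fluxes of  *)
(* node i, and the last four are the windings f, D, g, Q.                      *)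
Notation ncoord n := (n.+1 * 2 + 4)%N.

Definition node_of {n : nat} (k : nat) : 'I_n.+1 := inord k./2.

(* Reciprocal of an inductance or resistance in ]0, +oo], with (+oo)^-1 = 0. *)
Definition recip {R : realType} (x : \bar R) : R := fine (x^-1)%E.

Definition posdef {R : realType} {m : nat} (G : 'M[R]_m) : Prop :=
  G^T = G /\ forall x : 'cV[R]_m, x != 0 -> 0 < (x^T *m G *m x) 0 0.

Definition nodal_laplacian {R : realType} {n : nat}
    (ell : 'I_n.+1 -> 'I_n.+1 -> \bar R) (i j : 'I_n.+1) : R :=
  if i == j then \sum_(k | k != i) recip (ell i k) else - recip (ell i j).

(* The alpha and beta components do not interact: entries vanish unless the    *)
(* two coordinates have the same parity.                                       *)
Definition Lmat {R : realType} {n : nat}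
    (ell : 'I_n.+1 -> 'I_n.+1 -> \bar R) : 'M[R]_(n.+1 * 2) :=
  \matrix_(k, l) if odd k == odd l
                 then nodal_laplacian ell (node_of k) (node_of l) else 0.

Definition KL {R : realType} {n : nat}
    (ell : 'I_n.+1 -> 'I_n.+1 -> \bar R) : 'M[R]_(ncoord n) :=
  block_mx (Lmat ell) 0 0 0.

Definition KR {R : realType} {n : nat} (r : 'I_n.+1 -> \bar R)
    (rf rD rg rQ : R) : 'M[R]_(ncoord n) :=
  diag_mx (row_mx (\row_k recip (r (node_of k)))
                  (\row_j [:: rf^-1; rD^-1; rg^-1; rQ^-1]`_j)).

Definition omega_s {R : realType} : R := 120 * pi.

Definition forcing {R : realType} {n : nat} (r : 'I_n.+1 -> \bar R)
    (rf Us Uf : R) (t : R) : 'cV[R]_(ncoord n) :=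
  col_mx (\col_k if (k < 2)%N then Us * recip (r ord0) * cos (omega_s * t)
                 else 0)
         (\col_j if j == 0 then Uf / rf else 0).

Definition Pmat {R : realType} (th : R) : 'M[R]_6 :=
  block_mx
    (\matrix_(i < 2, j < 2) if i == j then cos th
                            else if (i < j)%N then - sin th else sin th)
    0 0 (1%:M : 'M[R]_4).

Lemma ncoordE (n : nat) : (n * 2 + 6 = ncoord n)%N.
Proof. by rewrite mulSn -!addnA (addnC 2) -addnA. Qed.

(* The cast only identifies the dimension 2(n-1)+6 of the block decomposition  *)
(* at hand with the dimension 2n+4, n here being the number of nodes.          *)
Definition Gamma {R : realType} {n : nat} (Gamma0 : 'M[R]_6) (th : R) :
    'M[R]_(ncoord n) :=
  castmx (ncoordE n, ncoordE n)
    (block_mx (0 : 'M[R]_(n * 2)) 0 0 (Pmat th *m Gamma0 *m Pmat (- th))).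

Definition Nmat {R : realType} {n : nat} (ell : 'I_n.+1 -> 'I_n.+1 -> \bar R)
    (Gamma0 : 'M[R]_6) (th : R) : 'M[R]_(ncoord n) :=
  KL ell + Gamma Gamma0 th.

Definition Jmat {R : realType} (J : 6.-tuple R) : 'M[R]_6 :=
  diag_mx (\row_i J`_i).

Definition Dmat {R : realType} : 'M[R]_6 := 0.

(* Out-of-range entries of a sequence are 0, so the first and the last         *)
(* diagonal entries are K_1 and K_5.                                           *)
Definition Kmat {R : realType} (K : 5.-tuple R) : 'M[R]_6 :=
  \matrix_(i, j)
    if i == j then (0 :: K)`_i + K`_i
    else if j == i.+1 :> nat then - K`_i
    else if i == j.+1 :> nat then - K`_j else 0.

(* (T_1, T_2, T_3, T_4, 0, 0). *)
Definition Tvec {R : realType} (T : 4.-tuple R) : 'cV[R]_6 := \col_i T`_i.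

Definition fifth : 'I_6 := inord 4.

(* (Psi, theta) is a (classical) solution, on the open time interval ]a, b[,   *)
(* of the system                                                               *)
(*    KR Psi' + S(theta_5) Psi = f(t)                                          *)
(*    J theta'' + D theta' + K theta                                           *)
(*      + 1/2 (Psi^T (dG/dtheta)(theta_5) Psi) e_5 = T.                        *)
Definition solves {R : realType} {d : nat} (KR : 'M[R]_d) (S G : R -> 'M[R]_d)
    (f : R -> 'cV[R]_d) (J D K : 'M[R]_6) (T : 'cV[R]_6) (a b : \bar R)
    (Psi : R -> 'cV[R]_d) (theta : R -> 'cV[R]_6) : Prop :=
  forall t : R, (a < t%:E < b)%E ->
    [/\ derivable Psi t 1,
        derivable theta t 1,
        derivable (derive1 theta) t 1,
        KR *m derive1 Psi t + S (theta t fifth 0) *m Psi t = f t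
      & J *m derive1 (derive1 theta) t + D *m derive1 theta t + K *m theta t
        + (2^-1 * ((Psi t)^T *m derive1 G (theta t fifth 0) *m Psi t) 0 0)
            *: delta_mx fifth 0 = T].

Definition Lambda1 {R : realType} {n : nat} (r : 'I_n.+1 -> \bar R) :
    {set 'I_(ncoord n)} :=
  [set k : 'I_(ncoord n) | (k < n.+1 * 2)%N & r (node_of k) == +oo%E].

Definition Lambda2 {R : realType} {n : nat} (r : 'I_n.+1 -> \bar R) :
    {set 'I_(ncoord n)} := ~: Lambda1 r.

Definition submat {R : realType} {d : nat} (A B : {set 'I_d}) (M : 'M[R]_d) :
    'M[R]_(#|A|, #|B|) := mxsub enum_val enum_val M.

Definition subvec {R : realType} {d : nat} (A : {set 'I_d}) (v : 'cV[R]_d) :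
    'cV[R]_#|A| := rowsub enum_val v.

(* Nodes are not re-numbered: this permutation matrix takes a vector whose     *)
(* A-coordinates are listed before its B-coordinates back to the original      *)
(* order, when B is the complement of A.                                       *)
Definition reorder {R : realType} {d : nat} (A B : {set 'I_d}) :
    'M[R]_(d, #|A| + #|B|) :=
  row_mx (colsub enum_val 1%:M) (colsub enum_val 1%:M).

Definition Amat {R : realType} {n : nat} (ell : 'I_n.+1 -> 'I_n.+1 -> \bar R)
    (r : 'I_n.+1 -> \bar R) (Gamma0 : 'M[R]_6) (th : R) :
    'M[R]_(ncoord n, #|Lambda2 r|) :=
  let N := Nmat ell Gamma0 th in
  reorder (Lambda1 r) (Lambda2 r) *m
  col_mx (- (invmx (submat (Lambda1 r) (Lambda1 r) N)
             *m submat (Lambda1 r) (Lambda2 r) N))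
         1%:M.

Definition Ntilde {R : realType} {n : nat}
    (ell : 'I_n.+1 -> 'I_n.+1 -> \bar R) (r : 'I_n.+1 -> \bar R)
    (Gamma0 : 'M[R]_6) (th : R) : 'M[R]_#|Lambda2 r| :=
  (Amat ell r Gamma0 th)^T *m Nmat ell Gamma0 th *m Amat ell r Gamma0 th.

Definition KRtilde {R : realType} {n : nat} (r : 'I_n.+1 -> \bar R)
    (rf rD rg rQ : R) : 'M[R]_#|Lambda2 r| :=
  diag_mx (\row_k KR r rf rD rg rQ (enum_val k) (enum_val k)).

(* Every node with r_i = +oo is joined, through finite inductances, to a node  *)
(* with a finite resistance or to the generator node. This holds as soon as    *)
(* the circuit is connected, since node ord0 has a finite resistance. It is    *)
(* the exact condition for the inverse of N_{Lambda1,Lambda1} in Amat to       *)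
(* exist: otherwise a whole component of the inductance graph lies in Lambda1  *)
(* away from the generator, and the Laplacian of a component is singular.      *)
Definition grounded {R : realType} {n : nat}
    (ell : 'I_n.+1 -> 'I_n.+1 -> \bar R) (r : 'I_n.+1 -> \bar R) : Prop :=
  forall i : 'I_n.+1, r i = +oo%E ->
    exists2 j : 'I_n.+1, r j != +oo%E \/ j = ord_max
      & connect [rel u v | (u != v) && (ell u v != +oo%E)] i j.

(* Main.v *)
Require Import Defs.
From mathcomp Require Import all_boot all_order all_algebra.
From mathcomp Require Import all_classical all_reals all_analysis.
From mathcomp Require Import ring lra zify.
Import numFieldTopology.Exports numFieldNormedType.Exports.
Import Order.TTheory GRing.Theory Num.Theory.

(** Let E1 and E2 be the 0-1 matrices that extract the coordinates in Lambda1
    and in Lambda2, and write N_ij = E_i N E_j^T, so that the matrix A of the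
    statement is E2^T - E1^T N_11^-1 N_12. The rows of (O) in Lambda1 carry
    neither a time derivative (their resistances are infinite) nor a source
    term: they are the algebraic constraint E1 N Psi = 0, which says exactly
    that Psi = A (E2 Psi). Two identities then carry everything:
    E2 A = 1 and E1 N A = 0. Since the vectors in the range of N A vanish on
    Lambda1, N A = E2^T Ntilde with Ntilde = A^T N A, and the rows of (O) in
    Lambda2 become the first equation of (R); this works in both directions
    ([solves_reduce], [solves_lift]).

    For the second equation, differentiating E2 A = 1 gives E2 A' = 0, hence
    A'^T N A = A'^T E2^T Ntilde = 0, and also A^T N A' = 0 by symmetry of N.
    Of the three terms of (A^T N A)' there remains A^T N' A = A^T Gamma' A:
    the quadratic forms of Gamma' at A v and of Ntilde' at v agree
    ([derive1_reduced]). Differentiability of A rests on Cramer's rule for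
    the inverse ([derivable_invmx]).

    That N_11 is invertible is an energy argument. The quadratic form of N is
    the sum of the Dirichlet energy of the inductance network and of a
    generator term that vanishes only if the last six coordinates do. If x is
    supported on Lambda1 and has zero energy, its components are constant
    along finite inductances and zero at the generator node; since every node
    with infinite resistance is joined to the generator node or to a node
    outside Lambda1, x = 0 ([Nmat_form_eq0]). *)

Local Open Scope ring_scope.

(** * Differentiation of matrix-valued functions *)

Section MatrixCalculus.
Context {R : realType}.

Lemma derivable_mx_entry {m p} {F : R -> 'M[R]_(m, p)} {x} :
  derivable F x 1 -> forall i j, derivable (fun t => F t i j) x 1.
Proof. by move/derivable_mxP. Qed.

Lemma derive1_mxE {m p} {F : R -> 'M[R]_(m, p)} {x} : derivable F x 1 ->
  forall i j, derive1 F x i j = derive1 (fun t => F t i j) x.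
Proof. by move=> dF i j; rewrite !derive1E derive_mx// mxE. Qed.

Lemma derivable_sumr {I : Type} (s : seq I) (P : pred I) (f : I -> R -> R) x :
  (forall i, P i -> derivable (f i) x 1) ->
  derivable (fun t => \sum_(i <- s | P i) f i t) x 1.
Proof.
move=> df; elim: s => [|i s IH].
  by under eq_fun do rewrite big_nil; exact: derivable_cst.
under eq_fun do rewrite big_cons.
by case: ifP => [Pi|_]; [apply: derivableD; [exact: df|exact: IH]|exact: IH].
Qed.

Lemma derivable_prodr {I : Type} (s : seq I) (P : pred I) (f : I -> R -> R) x :
  (forall i, P i -> derivable (f i) x 1) ->
  derivable (fun t => \prod_(i <- s | P i) f i t) x 1.
Proof.
move=> df; elim: s => [|i s IH].
  by under eq_fun do rewrite big_nil; exact: derivable_cst.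
under eq_fun do rewrite big_cons.
by case: ifP => [Pi|_]; [apply: derivableM; [exact: df|exact: IH]|exact: IH].
Qed.

Lemma derivable_mulmx {m p q} {F : R -> 'M[R]_(m, p)} {G : R -> 'M[R]_(p, q)}
    {x} : derivable F x 1 -> derivable G x 1 ->
  derivable (fun t => F t *m G t) x 1.
Proof.
move=> dF dG; apply/derivable_mxP => i j; under eq_fun do rewrite mxE.
apply: derivable_sumr => k _.
exact: derivableM (derivable_mx_entry dF i k) (derivable_mx_entry dG k j).
Qed.

Lemma derive1_mulmx {m p q} {F : R -> 'M[R]_(m, p)} {G : R -> 'M[R]_(p, q)}
    {x} : derivable F x 1 -> derivable G x 1 ->
  derive1 (fun t => F t *m G t) x = derive1 F x *m G x + F x *m derive1 G x.
Proof.
move=> dF dG; apply/matrixP => i j.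
rewrite derive1_mxE; last exact: derivable_mulmx.
rewrite !mxE -big_split/= derive1E.
have -> : (fun t => (F t *m G t) i j) =
          \sum_k ((fun t => F t i k) * (fun t => G t k j)).
  by apply/funext => t; rewrite mxE fct_sumE.
have dFk k := derivable_mx_entry dF i k.
have dGk k := derivable_mx_entry dG k j.
rewrite derive_sum => [|k]; last exact: derivableM (dFk k) (dGk k).
apply: eq_bigr => k _; rewrite (deriveM (dFk k) (dGk k)).
rewrite (derive1_mxE dF) (derive1_mxE dG) !derive1E addrC.
congr (_ + _); exact: mulrC.
Qed.

Lemma derive1_mulmxl {m p q} (A : 'M[R]_(m, p)) {G : R -> 'M[R]_(p, q)} {x} :
  derivable G x 1 -> derive1 (fun t => A *m G t) x = A *m derive1 G x.
Proof.
move=> dG; rewrite (derive1_mulmx (derivable_cst A x 1) dG).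
by rewrite derive1_cst mul0mx add0r.
Qed.

Lemma derivable_trmx {m p} {F : R -> 'M[R]_(m, p)} {x} :
  derivable F x 1 -> derivable (fun t => (F t)^T) x 1.
Proof.
move=> dF; apply/derivable_mxP => i j; under eq_fun do rewrite mxE.
exact: derivable_mx_entry.
Qed.

Lemma derive1_trmx {m p} {F : R -> 'M[R]_(m, p)} {x} :
  derivable F x 1 -> derive1 (fun t => (F t)^T) x = (derive1 F x)^T.
Proof.
move=> dF; apply/matrixP => i j.
rewrite derive1_mxE; last exact: derivable_trmx.
rewrite mxE (derive1_mxE dF); congr (derive1 _ x); apply/funext => t.
exact: mxE.
Qed.

Lemma derivable_det {m} {F : R -> 'M[R]_m} {x} :
  derivable F x 1 -> derivable (fun t => \det (F t)) x 1.
Proof.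
move=> dF; apply: derivable_sumr => s _; apply: derivableM.
  exact: derivable_cst.
by apply: derivable_prodr => i _; exact: derivable_mx_entry.
Qed.

(** Cramer's rule reduces the inverse to determinants of minors. *)
Lemma derivable_invmx {m} {F : R -> 'M[R]_m} {x} :
  (forall t, F t \in unitmx) -> derivable F x 1 ->
  derivable (fun t => invmx (F t)) x 1.
Proof.
move=> uF dF; under eq_fun do rewrite /invmx uF.
apply/derivable_mxP => i j; under eq_fun do rewrite !mxE.
apply: derivableM.
  apply: derivableV; last exact: derivable_det.
  by rewrite -unitfE -unitmxE.
apply: derivableM; first exact: derivable_cst.
apply: derivable_det; apply/derivable_mxP => k l.
by under eq_fun do rewrite !mxE; exact: derivable_mx_entry.
Qed.

Lemma derivable_mx_comp {m p} {F : R -> 'M[R]_(m, p)} {g : R -> R} {x} :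
  derivable g x 1 -> derivable F (g x) 1 -> derivable (fun t => F (g t)) x 1.
Proof.
move=> /derivable1_diffP dg /derivable_mx_entry dF; apply/derivable_mxP => i j.
apply/derivable1_diffP.
apply: (@differentiable_comp _ _ _ _ g (fun t => F t i j)) => //.
exact/derivable1_diffP/dF.
Qed.

End MatrixCalculus.

(** * Extraction of coordinates as a matrix product *)

Section Selection.
Context {R : realType} {d : nat}.
Implicit Type A : {set 'I_d}.

Definition select A : 'M[R]_(#|A|, d) := rowsub enum_val 1%:M.

Lemma subvecE A (v : 'cV[R]_d) : subvec A v = select A *m v.
Proof. exact: rowsubE. Qed.

Lemma select_tr A : (select A)^T = colsub enum_val 1%:M.
Proof. by rewrite trmx_mxsub tr_scalar_mx. Qed.

Lemma submatE A B (M : 'M[R]_d) :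
  submat A B M = select A *m M *m (select B)^T.
Proof.
rewrite select_tr mulmx_colsub mulmx1 -rowsubE; exact: mxsubcr.
Qed.

Lemma select_mul_tr A B : select A *m (select B)^T =
  \matrix_(i, j) (enum_val i == enum_val j)%:R.
Proof.
rewrite select_tr mulmx_colsub mulmx1; apply/matrixP => i j.
by rewrite !mxE.
Qed.

Lemma select_selectT A : select A *m (select A)^T = 1%:M.
Proof.
rewrite select_mul_tr; apply/matrixP => i j.
by rewrite !mxE (inj_eq enum_val_inj).
Qed.

Lemma select_selectCT A : select A *m (select (~: A))^T = 0.
Proof.
rewrite select_mul_tr; apply/matrixP => i j; rewrite !mxE.
case: eqP => // eij; have := enum_valP j.
by rewrite -eij inE enum_valP.
Qed.

Lemma select_selectTC A : select (~: A) *m (select A)^T = 0.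
Proof. by rewrite -[LHS]trmxK trmx_mul trmxK select_selectCT trmx0. Qed.

(** The two sets of coordinates exhaust the index set, so a vector is
    recovered from its two extracted parts. *)
Lemma select_partition A :
  (select A)^T *m select A + (select (~: A))^T *m select (~: A) = 1%:M.
Proof.
have H B k l : ((select B)^T *m select B) k l = ((k == l) && (k \in B))%:R.
  rewrite mxE (eq_bigr (fun i => (enum_val i == k)%:R * (enum_val i == l)%:R)).
    rewrite -(big_enum_val (fun i => (i == k)%:R * (i == l)%:R : R)) /=.
    case: (boolP (k \in B)) => [kB|kB].
      rewrite (bigD1 k)//= eqxx mul1r andbT big1 ?addr0// => i /andP[_].
      by move=> /negbTE ->; rewrite mul0r.
    rewrite andbF big1// => i iB; case: eqP => [ik|]; last by rewrite mul0r.
    by rewrite ik (negbTE kB) in iB.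
  by move=> i _; rewrite !mxE.
apply/matrixP => k l; rewrite [LHS]mxE !H mxE inE.
by case: (k == l) => /=; case: (k \in A) => /=; rewrite ?addr0 ?add0r.
Qed.

End Selection.

(** * Elimination of the coordinates without derivative *)

(** The reduction is independent of circuits: only the relations between the
    extraction matrices E1 and E2, the symmetry of N = L + G and the
    invertibility of E1 N E1^T matter. *)
Section Reduction.
Context {R : realType} {d p q : nat}.
Variables (E1 : 'M[R]_(p, d)) (E2 : 'M[R]_(q, d)).
Hypotheses (E22 : E2 *m E2^T = 1%:M) (E12 : E1 *m E2^T = 0).
Hypothesis (E_1 : E1^T *m E1 + E2^T *m E2 = 1%:M).

Variables (L : 'M[R]_d) (G : R -> 'M[R]_d).
Let N th := L + G th.
Hypotheses (dG : forall th, derivable G th 1).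
Hypotheses (N_sym : forall th, (N th)^T = N th).
Let N11 th := E1 *m N th *m E1^T.
Let N12 th := E1 *m N th *m E2^T.
Hypothesis N11_unit : forall th, N11 th \in unitmx.

(** Given the coordinates extracted by E2, restores those extracted by E1 so
    that E1 M vanishes on the result. *)
Definition schur_lift (M : 'M[R]_d) : 'M[R]_(d, q) :=
  E2^T - E1^T *m (invmx (E1 *m M *m E1^T) *m (E1 *m M *m E2^T)).

Let A th := schur_lift (N th).
Let Nt th := (A th)^T *m N th *m A th.

Let E21 : E2 *m E1^T = 0.
Proof. by rewrite -[LHS]trmxK trmx_mul trmxK E12 trmx0. Qed.

Lemma select2_lift th : E2 *m A th = 1%:M.
Proof. by rewrite mulmxBr E22 mulmxA E21 mul0mx subr0. Qed.

(** The lift solves the constraint: E1 N A = N_12 - N_11 N_11^-1 N_12. *)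
Lemma select1_lift th : E1 *m (N th *m A th) = 0.
Proof.
rewrite /A /schur_lift !mulmxBr !mulmxA -/(N11 th) -/(N12 th).
by rewrite mulmxV ?N11_unit// mul1mx subrr.
Qed.

Lemma split_select m (M : 'M[R]_(d, m)) :
  M = E1^T *m (E1 *m M) + E2^T *m (E2 *m M).
Proof. by rewrite !mulmxA -mulmxDl E_1 mul1mx. Qed.

(** By E1 N A = 0 and E2 A = 1, the left factor A^T only extracts rows: the
    reduced matrix is the Schur complement of N_11. *)
Lemma reducedE th : Nt th = E2 *m (N th *m A th).
Proof.
rewrite /Nt -mulmxA [N th *m A th]split_select select1_lift mulmx0 add0r.
rewrite [LHS]mulmxA -trmx_mul select2_lift trmx1 mul1mx.
by rewrite [in RHS]mulmxA E22 mul1mx.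
Qed.

Lemma mul_lift th : N th *m A th = E2^T *m Nt th.
Proof.
by rewrite reducedE {1}[N th *m A th]split_select select1_lift mulmx0 add0r.
Qed.

Lemma derivable_N th : derivable N th 1.
Proof. exact: derivableD (derivable_cst _ _ _) (dG th). Qed.

Lemma derive1_N th : derive1 N th = derive1 G th.
Proof.
by rewrite !derive1E (deriveD (derivable_cst _ _ _) (dG th)) derive_cst add0r.
Qed.

Lemma derivable_lift th : derivable A th 1.
Proof.
have dE m1 m2 (B : 'M[R]_(m1, d)) (C : 'M[R]_(d, m2)) :
    derivable (fun th => B *m N th *m C) th 1.
  apply: derivable_mulmx (derivable_cst _ _ _).
  exact: derivable_mulmx (derivable_cst _ _ _) (derivable_N th).
apply: (derivableB (derivable_cst _ _ _)).
apply: derivable_mulmx (derivable_cst _ _ _) _.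
apply: derivable_mulmx (dE _ _ _ _).
exact: derivable_invmx N11_unit (dE _ _ _ _).
Qed.

Lemma derivable_reduced th : derivable Nt th 1.
Proof.
apply: derivable_mulmx (derivable_lift th).
exact: derivable_mulmx (derivable_trmx (derivable_lift th)) (derivable_N th).
Qed.

(** Differentiating E2 A = 1 shows that A' takes its values in the eliminated
    coordinates, where N A vanishes. *)
Lemma derive1_lift_orth th : (derive1 A th)^T *m (N th *m A th) = 0.
Proof.
have E2A' : E2 *m derive1 A th = 0.
  rewrite -(derive1_mulmxl E2 (derivable_lift th)).
  under eq_fun do rewrite select2_lift.
  exact: derive1_cst.
by rewrite mul_lift mulmxA -trmx_mul E2A' trmx0 mul0mx.
Qed.

(** In the product rule for A^T N A, both terms containing A' vanish by
    [derive1_lift_orth], the second one by transposition; L is constant. *)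
Lemma derive1_reduced th :
  derive1 Nt th = (A th)^T *m derive1 G th *m A th.
Proof.
have dA := derivable_lift th; have dN := derivable_N th.
rewrite (derive1_mulmx (derivable_mulmx (derivable_trmx dA) dN) dA).
rewrite (derive1_mulmx (derivable_trmx dA) dN) derive1_trmx//.
have -> : (A th)^T *m N th *m derive1 A th = 0.
  have := congr1 trmx (derive1_lift_orth th).
  by rewrite !trmx_mul trmxK N_sym trmx0.
by rewrite addr0 mulmxDl -mulmxA derive1_lift_orth add0r derive1_N.
Qed.

Variables (K : 'M[R]_d) (Kt : 'M[R]_q) (f : R -> 'cV[R]_d).
Hypotheses (KE : K = E2^T *m Kt *m E2) (f1 : forall t, E1 *m f t = 0).
Variables (J D S : 'M[R]_6) (T : 'cV[R]_6) (a b : \bar R).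

Let quad_lift th (v : 'cV[R]_q) :
  (A th *m v)^T *m derive1 G th *m (A th *m v) = v^T *m derive1 Nt th *m v.
Proof. by rewrite derive1_reduced trmx_mul !mulmxA. Qed.

(** Multiplying the flux equation by E1 kills K and f and leaves the constraint
    that determines Psi from E2 Psi; multiplying it by E2 gives the reduced
    equation. *)
Lemma solves_reduce Psi theta :
  solves K N G f J D S T a b Psi theta ->
  solves Kt Nt Nt (fun t => E2 *m f t) J D S T a b
    (fun t => E2 *m Psi t) theta.
Proof.
move=> sol t tab; have [dPsi dth ddth eqPsi eqth] := sol t tab.
set th := theta t fifth 0 in eqPsi eqth *.
have PsiE : Psi t = A th *m (E2 *m Psi t).
  (* the constraint, solved for the eliminated coordinates *)
  have : N11 th *m (E1 *m Psi t) = - (N12 th *m (E2 *m Psi t)).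
    apply/eqP; rewrite -addr_eq0; apply/eqP.
    rewrite -![_ *m _ *m _ *m _]mulmxA -!mulmxDr -[_ + _]split_select.
    have : E1 *m (K *m derive1 Psi t + N th *m Psi t) = 0 by rewrite eqPsi f1.
    by rewrite KE mulmxDr !mulmxA E12 !mul0mx add0r.
  move/(congr1 (mulmx (invmx (N11 th)))); rewrite mulKmx// mulmxN => E1Psi.
  rewrite mulmxBl {1}[Psi t]split_select E1Psi mulmxN addrC.
  by rewrite !mulmxA.
split => //.
- exact: derivable_mulmx (derivable_cst _ _ _) dPsi.
- rewrite (derive1_mulmxl E2 dPsi) reducedE -!mulmxA -PsiE -eqPsi.
  by rewrite mulmxDr KE !mulmxA E22 mul1mx.
- by rewrite -quad_lift -PsiE.
Qed.

(** K only sees E2 Psi, and E2 A = 1: the derivative of A along theta, which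
    is part of the derivative of the lifted flux, is annihilated by K. *)
Lemma solves_lift Psit theta :
  solves Kt Nt Nt (fun t => E2 *m f t) J D S T a b Psit theta ->
  solves K N G f J D S T a b
    (fun t => A (theta t fifth 0) *m Psit t) theta.
Proof.
move=> sol t tab; have [dPsi dth ddth eqPsi eqth] := sol t tab.
have dPsiA : derivable (fun t => A (theta t fifth 0) *m Psit t) t 1.
  apply: derivable_mulmx dPsi.
  by apply: derivable_mx_comp (derivable_lift _); exact: derivable_mx_entry.
split => //.
- rewrite KE -!mulmxA -(derive1_mulmxl E2 dPsiA).
  under eq_fun do rewrite mulmxA select2_lift mul1mx.
  rewrite [N _ *m _]mulmxA mul_lift -mulmxA -mulmxDr eqPsi.
  by rewrite [RHS]split_select f1 mulmx0 add0r.
- by rewrite quad_lift.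
Qed.

End Reduction.

(** * The generator term *)

(** With [Pmat_mulV], this says that P is orthogonal: Gamma is a congruence
    transform of Gamma0, which keeps symmetry and definiteness. *)
Lemma Pmat_opp {R : realType} (th : R) : Pmat (- th) = (Pmat th)^T.
Proof.
apply: etrans (esym (@tr_block_mx _ 2 4 2 4 _ _ _ _)).
rewrite /Pmat !trmx0 trmx1 cosN sinN opprK; congr block_mx.
apply/matrixP => i j; rewrite !mxE eq_sym.
by case: eqVneq => // ij; case: ltngtP => // /val_inj eij; rewrite eij eqxx in ij.
Qed.

Lemma Pmat_mulV {R : realType} (th : R) : Pmat th *m Pmat (- th) = 1%:M.
Proof.
apply: etrans (@mulmx_block _ 2 4 2 4 2 4 _ _ _ _ _ _ _ _) _.
rewrite !mulmx0 !mul0mx !addr0 !add0r mulmx1.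
apply: etrans (esym (@scalar_mx_block _ 2 4 _)); congr block_mx.
have cs : cos th * cos th + sin th * sin th = 1 by rewrite -!expr2 cos2Dsin2.
apply/matrixP => -[[|[|//]] i2] [[|[|//]] j2].
all: rewrite !mxE !big_ord_recl big_ord0 addr0 !mxE cosN sinN /=; lra.
Qed.

Lemma derivable_block_mx {R : realType} {m1 m2 n1 n2 : nat}
    {A : R -> 'M[R]_(m1, n1)} {B : R -> 'M[R]_(m1, n2)}
    {C : R -> 'M[R]_(m2, n1)} {D : R -> 'M[R]_(m2, n2)} {x : R} :
  derivable A x 1 -> derivable B x 1 -> derivable C x 1 -> derivable D x 1 ->
  derivable (fun t => block_mx (A t) (B t) (C t) (D t)) x 1.
Proof.
move=> dA dB dC dD; apply/derivable_mxP => i j.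
have [i' ->|i' ->] := split_ordP i; have [j' ->|j' ->] := split_ordP j.
- under eq_fun do rewrite block_mxEul; exact: (derivable_mx_entry dA).
- under eq_fun do rewrite block_mxEur; exact: (derivable_mx_entry dB).
- under eq_fun do rewrite block_mxEdl; exact: (derivable_mx_entry dC).
- under eq_fun do rewrite block_mxEdr; exact: (derivable_mx_entry dD).
Qed.

Lemma derivable_Pmat {R : realType} (th : R) : derivable (@Pmat R) th 1.
Proof.
have dcst m p (A : 'M[R]_(m, p)) : derivable (fun=> A) th 1.
  exact: derivable_cst.
refine (@derivable_block_mx R 2 4 2 4 _ _ _ _ th _
  (dcst _ _ 0) (dcst _ _ 0) (dcst _ _ 1%:M)).
apply/derivable_mxP => i j; under eq_fun do rewrite mxE.
case: (i == j); first exact: (@derivable_cos R th).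
case: (i < j)%N; last exact: (@derivable_sin R th).
exact: derivableN (@derivable_sin R th).
Qed.

Section GeneratorCoupling.
Context {R : realType} {n : nat}.

Definition gen_coord (j : 'I_6) : 'I_(ncoord n) :=
  cast_ord (ncoordE n) (rshift (n * 2) j).

Definition gen_select : 'M[R]_(6, ncoord n) := rowsub gen_coord 1%:M.

(** Replaces the cast block matrix by a product, on which transposition,
    differentiation and quadratic forms are computed directly. *)
Lemma GammaE (Gamma0 : 'M[R]_6) th :
  Gamma Gamma0 th =
  gen_select^T *m (Pmat th *m Gamma0 *m Pmat (- th)) *m gen_select.
Proof.
rewrite /Gamma; set X := _ *m Pmat _.
(* Stated for any dimension k equal to n * 2 + 6, so that the cast can be
   removed by eliminating the equality. *)
have castE k (e : (n * 2 + 6 = k)%N) (g : 'I_6 -> 'I_k) :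
    (forall j, g j = cast_ord e (rshift (n * 2) j)) ->
    castmx (e, e) (block_mx (0 : 'M[R]_(n * 2)) 0 0 X) =
    (rowsub g 1%:M)^T *m X *m rowsub g 1%:M.
  case: k / e g => g gE; rewrite castmx_id.
  have -> : rowsub g 1%:M = row_mx 0 1%:M :> 'M[R]_(6, n * 2 + 6).
    apply/matrixP => i j; rewrite mxE gE cast_ord_id [RHS]mxE mxE.
    case: splitP => j' jE; rewrite mxE -val_eqE /= jE.
      by case: eqP => // ij; have := ltn_ord j'; rewrite -ij; lia.
    by rewrite eqn_add2l.
  rewrite tr_row_mx trmx0 trmx1 mul_col_mx mul0mx mul1mx mul_col_mx mul0mx.
  by rewrite mul_mx_row mulmx0 mulmx1 /block_mx row_mx0.
exact: castE.
Qed.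

Lemma derivable_Gamma (Gamma0 : 'M[R]_6) th :
  derivable (Gamma (n:=n) Gamma0) th 1.
Proof.
rewrite (_ : Gamma Gamma0 =
  fun th => gen_select^T *m (Pmat th *m Gamma0 *m Pmat (- th)) *m gen_select).
  have dP := derivable_Pmat th.
  apply: derivable_mulmx (derivable_cst _ _ _).
  apply: derivable_mulmx (derivable_cst _ _ _) _.
  apply: derivable_mulmx (derivable_mulmx dP (derivable_cst _ _ _)) _.
  by under eq_fun do rewrite Pmat_opp; exact: derivable_trmx.
by apply/funext => t; exact: GammaE.
Qed.

Lemma trmx_Gamma (Gamma0 : 'M[R]_6) th : posdef Gamma0 ->
  (Gamma (n:=n) Gamma0 th)^T = Gamma Gamma0 th.
Proof.
by move=> [G0 _]; rewrite GammaE Pmat_opp !trmx_mul !trmxK G0 !mulmxA.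
Qed.

Lemma Gamma_form (Gamma0 : 'M[R]_6) th (x : 'cV[R]_(ncoord n)) :
  posdef Gamma0 ->
  0 <= (x^T *m Gamma Gamma0 th *m x) 0 0 ?= iff (gen_select *m x == 0).
Proof.
move=> [_ G0]; set y := gen_select *m x.
have -> : x^T *m Gamma Gamma0 th *m x =
    (Pmat (- th) *m y)^T *m Gamma0 *m (Pmat (- th) *m y).
  by rewrite GammaE /y {2}Pmat_opp !trmx_mul !trmxK !mulmxA.
have [y0|yn0] := eqVneq y 0.
  by apply/leifP; rewrite y0 mulmx0 trmx0 !mul0mx mxE eqxx.
apply/leifP; rewrite G0//; apply: contra_neq yn0 => Py.
by rewrite -[y]mul1mx -(Pmat_mulV th) -mulmxA Py mulmx0.
Qed.

End GeneratorCoupling.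

(** * The energy of the inductance network *)

(** Summing w k l * u k * (u k - u l) over ordered pairs and exchanging k and l
    symmetrizes the form into squares. *)
Lemma laplacian_form {R : realFieldType} {d : nat} (M : 'M[R]_d)
    (w : 'I_d -> 'I_d -> R) (u : 'cV[R]_d) :
  (forall k l, w k l = w l k) ->
  (forall k l, M k l = (if k == l then \sum_m w k m else 0) - w k l) ->
  (u^T *m M *m u) 0 0 =
  2^-1 * \sum_k \sum_l w k l * (u k 0 - u l 0) ^+ 2.
Proof.
move=> wC ME.
have formE : (u^T *m M *m u) 0 0 =
    \sum_k \sum_l w k l * (u k 0 * (u k 0 - u l 0)).
  rewrite -mulmxA mxE; apply: eq_bigr => k _; rewrite !mxE.
  under eq_bigr do rewrite ME mulrBl.
  rewrite sumrB (bigD1 k)//= eqxx [X in _ + X - _]big1 ?addr0; last first.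
    by move=> l /negbTE; rewrite eq_sym => ->; rewrite mul0r.
  rewrite mulrBr mulr_suml !mulr_sumr -sumrB.
  by apply: eq_bigr => l _; ring.
have formE' : (u^T *m M *m u) 0 0 =
    \sum_k \sum_l w k l * (u l 0 * (u l 0 - u k 0)).
  rewrite formE exchange_big; apply: eq_bigr => k _; apply: eq_bigr => l _.
  by rewrite wC.
suff -> : \sum_k \sum_l w k l * (u k 0 - u l 0) ^+ 2 =
    (u^T *m M *m u) 0 0 + (u^T *m M *m u) 0 0 by field.
rewrite {1}formE formE' -big_split; apply: eq_bigr => k _.
by rewrite -big_split; apply: eq_bigr => l _ /=; ring.
Qed.

(** Node fluxes are indexed by a node and a phase, alpha or beta, which is the
    parity of the coordinate. *)
Section Nodes.
Context {n : nat}.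

Definition flux_coord (i : 'I_n.+1) (b : bool) : 'I_(n.+1 * 2) :=
  Ordinal (ltac:(have := ltn_ord i; case: b; lia) : i * 2 + b < n.+1 * 2)%N.

Lemma node_of_flux_coord i b : node_of (flux_coord i b) = i.
Proof.
apply: val_inj; rewrite /node_of val_insubd /=.
have := ltn_ord i; case: b; case: ifP; lia.
Qed.

Lemma odd_flux_coord i b : odd (flux_coord i b) = b.
Proof. by rewrite /= oddD oddM andbF; case: b. Qed.

Lemma flux_coordK (k : 'I_(n.+1 * 2)) : flux_coord (node_of k) (odd k) = k.
Proof.
apply: val_inj; rewrite /= /node_of val_insubd.
have := ltn_ord k; case: ifP; case: odd (odd_double_half k); lia.
Qed.

End Nodes.

Section Network.
Context {R : realType} {n : nat}.
Variable ell : 'I_n.+1 -> 'I_n.+1 -> \bar R.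
Hypothesis ell_sym : forall i j, ell i j = ell j i.
Hypothesis ell_gt0 : forall i j, i != j -> (0 < ell i j)%E.

(** The alpha and beta fluxes form two disjoint copies of the inductance
    network; this is the weight of an edge in their union. *)
Definition flux_weight (k l : 'I_(n.+1 * 2)) : R :=
  if (odd k == odd l) && (k != l) then recip (ell (node_of k) (node_of l))
  else 0.

Lemma eq_node_of (k l : 'I_(n.+1 * 2)) : odd k = odd l ->
  (node_of k == node_of l :> 'I_n.+1) = (k == l).
Proof.
move=> okl; apply/eqP/eqP => [e|->//].
by rewrite -(flux_coordK k) -(flux_coordK l) e okl.
Qed.

Lemma flux_weightC k l : flux_weight k l = flux_weight l k.
Proof. by rewrite /flux_weight eq_sym (eq_sym k) ell_sym. Qed.

Lemma flux_weight_ge0 k l : 0 <= flux_weight k l.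
Proof.
rewrite /flux_weight; case: ifP => // /andP[/eqP okl kl].
by rewrite fine_ge0// inve_ge0 ltW// ell_gt0// eq_node_of.
Qed.

Lemma flux_weight_gt0 (k l : 'I_(n.+1 * 2)) : odd k = odd l -> k != l ->
  ell (node_of k) (node_of l) != +oo%E -> 0 < flux_weight k l.
Proof.
move=> okl kl; rewrite /flux_weight okl eqxx kl/= /recip.
have := @ell_gt0 (node_of k) (node_of l); rewrite eq_node_of// => /(_ kl).
case: ell => [x| |]//; rewrite lte_fin => x0 _.
by rewrite inver gt_eqF//= invr_gt0.
Qed.

(** Reindexing by nodes, at fixed parity, identifies the diagonal entry with
    the total weight at k. *)
Lemma LmatE k l :
  Lmat ell k l = (if k == l then \sum_m flux_weight k m else 0)
                 - flux_weight k l.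
Proof.
rewrite mxE /nodal_laplacian /flux_weight.
have [okl|okl] := eqVneq (odd k) (odd l); last first.
  by rewrite subr0; case: eqVneq => // e; rewrite e eqxx in okl.
rewrite eq_node_of//; case: eqVneq => [_|_]; last by rewrite sub0r.
rewrite subr0 -big_mkcond /= (reindex (flux_coord^~ (odd k)))/=; last first.
  exists (fun m => node_of m) => [i _|m]; first exact: node_of_flux_coord.
  by rewrite unfold_in => /andP[/eqP -> _]; exact: flux_coordK.
apply: eq_big => [i|i _]; last by rewrite node_of_flux_coord.
rewrite odd_flux_coord eqxx /= -eq_node_of ?odd_flux_coord//.
by rewrite node_of_flux_coord eq_sym.
Qed.

Lemma trmx_Lmat : (Lmat ell)^T = Lmat ell.
Proof.
apply/matrixP => k l; rewrite mxE !LmatE flux_weightC eq_sym.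
by case: eqP => // ->.
Qed.

Lemma Lmat_form_ge0 (u : 'cV[R]_(n.+1 * 2)) : 0 <= (u^T *m Lmat ell *m u) 0 0.
Proof.
rewrite (laplacian_form _ _ u flux_weightC LmatE) mulr_ge0//.
by apply: sumr_ge0 => k _; apply: sumr_ge0 => l _;
  rewrite mulr_ge0 ?sqr_ge0 ?flux_weight_ge0.
Qed.

(** Zero energy forces equal fluxes across every finite inductance, since all
    terms of the energy are nonnegative. *)
Lemma Lmat_form_eq0 (u : 'cV[R]_(n.+1 * 2)) (k l : 'I_(n.+1 * 2)) :
  (u^T *m Lmat ell *m u) 0 0 = 0 -> odd k = odd l ->
  (node_of k != node_of l :> 'I_n.+1) ->
  ell (node_of k) (node_of l) != +oo%E -> u k 0 = u l 0.
Proof.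
move=> /eqP; rewrite (laplacian_form _ _ u flux_weightC LmatE).
have t0 i j : 0 <= flux_weight i j * (u i 0 - u j 0) ^+ 2.
  by rewrite mulr_ge0 ?sqr_ge0 ?flux_weight_ge0.
rewrite mulf_eq0 invr_eq0 pnatr_eq0/= psumr_eq0; last first.
  by move=> i _; exact: sumr_ge0.
move=> /allP/(_ k (mem_index_enum _)); rewrite implyTb psumr_eq0//.
move=> /allP/(_ l (mem_index_enum _)); rewrite implyTb mulf_eq0.
move=> + okl; rewrite eq_node_of// => + kl lkl.
by rewrite gt_eqF ?flux_weight_gt0//= sqrf_eq0 subr_eq0 => /eqP.
Qed.

Lemma KL_form (x : 'cV[R]_(ncoord n)) :
  x^T *m KL ell *m x = (usubmx x)^T *m Lmat ell *m usubmx x.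
Proof.
rewrite -{1 2}[x]vsubmxK /KL tr_col_mx mul_row_block !mulmx0 !addr0.
by rewrite mul_row_col mul0mx addr0.
Qed.

Variables (r : 'I_n.+1 -> \bar R) (Gamma0 : 'M[R]_6).
Hypothesis Gamma0_posdef : posdef Gamma0.
Hypothesis circuit_grounded : grounded ell r.

Lemma trmx_Nmat th : (Nmat ell Gamma0 th)^T = Nmat ell Gamma0 th.
Proof.
by rewrite /Nmat linearD/= trmx_Gamma// tr_block_mx !trmx0 trmx_Lmat.
Qed.

(** Zero energy makes the flux of each phase constant along paths of finite
    inductances and zero at the generator; by groundedness such a path leads
    from every node of Lambda1 to a node where the flux is zero. *)
Lemma Nmat_form_eq0 th (x : 'cV[R]_(ncoord n)) :
  (x^T *m Nmat ell Gamma0 th *m x) 0 0 = 0 ->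
  (forall k, k \in Lambda2 r -> x k 0 = 0) -> x = 0.
Proof.
rewrite /Nmat mulmxDr mulmxDl KL_form mxE; set u := usubmx x => form0 xL2.
have Gle := Gamma_form Gamma0 th x Gamma0_posdef.
have G0 := Gle.1; have L0 := Lmat_form_ge0 u.
have genx : gen_select *m x = 0 by apply/eqP; rewrite -(eq_leif Gle) eq_sym; lra.
have {form0 L0}form0 : (u^T *m Lmat ell *m u) 0 0 = 0 by lra.
have u_const b i j :
    connect [rel i j | (i != j) && (ell i j != +oo%E)] i j ->
    u (flux_coord i b) 0 = u (flux_coord j b) 0.
  move=> /connectP[s]; elim: s i => [i _ -> //|h s IH i /= /andP[/andP[ih lih]]].
  move=> hs js; rewrite -(IH h hs js).
  apply: Lmat_form_eq0 form0 _ _ _; rewrite ?odd_flux_coord//.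
    by rewrite !node_of_flux_coord.
  by rewrite !node_of_flux_coord.
apply/matrixP => k z; rewrite ord1 [RHS]mxE {z}.
have [kL1|kL1] := boolP (k \in Lambda1 r); last by rewrite xL2// inE.
move: kL1; rewrite inE => /andP[kn /eqP rk].
have [j jgrounded kj] := circuit_grounded (node_of k) rk.
have xE l : x (lshift 4 l) 0 = u l 0 by rewrite mxE.
have kE : lshift 4 (flux_coord (node_of k) (odd k)) = k.
  by apply: ord_inj; exact: (congr1 val (flux_coordK (Ordinal kn))).
rewrite -kE xE (u_const _ _ _ kj) -xE; case: jgrounded => [rj|->].
  by rewrite xL2// !inE /= node_of_flux_coord (negbTE rj) andbF.
(* The fluxes of the last node are the first two generator coordinates. *)
have -> : lshift 4 (flux_coord ord_max (odd k)) =
    gen_coord (inord (odd k)) :> 'I_(ncoord n).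
  by apply: ord_inj; rewrite /= inordK//; case: odd.
by move/colP/(_ (inord (odd k))): genx; rewrite -rowsubE !mxE.
Qed.

(** A kernel vector of N_11, extended by zero, is a vector of zero energy
    supported on Lambda1. *)
Lemma submat_Nmat_unit th :
  submat (Lambda1 r) (Lambda1 r) (Nmat ell Gamma0 th) \in unitmx.
Proof.
rewrite -row_free_unit; apply: inj_row_free => v; rewrite submatE => vN.
set x := (select (Lambda1 r))^T *m v^T.
have vE : v^T = select (Lambda1 r) *m x by rewrite mulmxA select_selectT mul1mx.
suff x0 : x = 0 by rewrite -[v]trmxK vE x0 mulmx0 trmx0.
apply: (@Nmat_form_eq0 th).
  have -> : x^T *m Nmat ell Gamma0 th *m x =
      v *m (select (Lambda1 r) *m Nmat ell Gamma0 th *m (select (Lambda1 r))^T)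
        *m v^T by rewrite trmx_mul !trmxK !mulmxA.
  by rewrite vN mul0mx mxE.
move=> k kL2; have : select (Lambda2 r) *m x = 0.
  by rewrite mulmxA select_selectTC mul0mx.
move/colP/(_ (enum_rank_in kL2 k)).
by rewrite -rowsubE !mxE enum_rankK_in// => ->.
Qed.

End Network.

(** * The circuit as an instance of the elimination *)

Section Assembly.
Context {R : realType} {n : nat}.
Variables (ell : 'I_n.+1 -> 'I_n.+1 -> \bar R) (r : 'I_n.+1 -> \bar R).

Lemma AmatE (Gamma0 : 'M[R]_6) th :
  Amat ell r Gamma0 th =
  schur_lift (select (Lambda1 r)) (select (Lambda2 r)) (Nmat ell Gamma0 th).
Proof.
rewrite /Amat /reorder mul_row_col mulmx1 mulmxN addrC -!select_tr.
by rewrite !submatE.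
Qed.

Lemma KR_Lambda1 (rf rD rg rQ : R) k l : k \in Lambda1 r ->
  KR r rf rD rg rQ k l = 0.
Proof.
rewrite inE => /andP[kn /eqP rk].
have -> : k = lshift 4 (Ordinal kn) by exact: val_inj.
rewrite !mxE /= (unsplitK (inl (Ordinal kn))) mxE.
by rewrite /recip rk invey mul0rn.
Qed.

(** The rows and columns of K_R in Lambda1 vanish, so K_R is supported on the
    retained coordinates. *)
Lemma KR_reduced (rf rD rg rQ : R) :
  KR r rf rD rg rQ =
  (select (Lambda2 r))^T *m KRtilde r rf rD rg rQ *m select (Lambda2 r).
Proof.
set K := KR r rf rD rg rQ; set E2 := select (Lambda2 r).
pose E1 : 'M[R]_(_, _) := select (Lambda1 r).
have K_sym : K^T = K by exact: tr_diag_mx.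
have E1K : E1 *m K = 0.
  rewrite -rowsubE; apply/matrixP => i j.
  by rewrite [LHS]mxE KR_Lambda1 ?enum_valP// mxE.
have KE1 : K *m E1^T = 0 by rewrite -[LHS]trmxK trmx_mul trmxK K_sym E1K trmx0.
have -> : KRtilde r rf rD rg rQ = E2 *m K *m E2^T.
  rewrite -submatE /KRtilde /K /KR; move: (row_mx _ _) => diag.
  by apply/matrixP => i j; rewrite !mxE !(inj_eq enum_val_inj) eqxx.
have E_1 : E1^T *m E1 + E2^T *m E2 = 1%:M by exact: select_partition.
rewrite -[LHS]mul1mx -E_1 mulmxDl -[_ *m _ *m K]mulmxA E1K mulmx0 add0r.
rewrite -[LHS]mulmx1 -E_1 mulmxDr.
by rewrite -!mulmxA (mulmxA K) KE1 mul0mx !mulmx0 add0r.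
Qed.

(** The sources sit at the first node and in the winding f, whose resistances
    are finite. *)
Lemma forcing_Lambda1 (rf Us Uf t : R) : (r ord0 < +oo)%E ->
  select (Lambda1 r) *m forcing r rf Us Uf t = 0.
Proof.
move=> r1_fin; rewrite -rowsubE; apply/matrixP => i j; rewrite ord1 !mxE.
have := enum_valP i; rewrite inE; set k := enum_val i => /andP[kn /eqP rk].
have kE : k = lshift 4 (Ordinal kn) by exact: val_inj.
rewrite {1}kE (unsplitK (inl (Ordinal kn))) mxE /=; case: ifP => // k2.
have node0 : node_of k = ord0 :> 'I_n.+1.
  apply: val_inj; rewrite /node_of val_insubd /=.
  by case: (nat_of_ord k) k2 => [|[|]].
by rewrite node0 in rk; rewrite rk in r1_fin.
Qed.

End Assembly.

Theorem theorem2p1 (R : realType) (n : nat)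
    (ell : 'I_n.+1 -> 'I_n.+1 -> \bar R) (r : 'I_n.+1 -> \bar R)
    (rf rD rg rQ Us Uf : R) (Gamma0 : 'M[R]_6)
    (Js : 6.-tuple R) (Ks : 5.-tuple R) (Ts : 4.-tuple R) (a b : \bar R)
    (ell_sym : forall i j, ell i j = ell j i)
    (ell_gt0 : forall i j, i != j -> (0 < ell i j)%E)
    (r_gt0 : forall i, (0 < r i)%E) (r1_fin : (r ord0 < +oo)%E)
    (rf_gt0 : 0 < rf) (rD_gt0 : 0 < rD) (rg_gt0 : 0 < rg) (rQ_gt0 : 0 < rQ)
    (Us_gt0 : 0 < Us) (Uf_gt0 : 0 < Uf)
    (Gamma0_posdef : posdef Gamma0)
    (circuit_grounded : grounded ell r) :
  let solves_O (Psi : R -> 'cV[R]_(ncoord n)) (theta : R -> 'cV[R]_6) :=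
    solves (KR r rf rD rg rQ)
           (fun th => KL ell + Gamma Gamma0 th) (Gamma Gamma0)
           (forcing r rf Us Uf) (Jmat Js) Dmat (Kmat Ks) (Tvec Ts)
           a b Psi theta in
  let solves_R (Psi : R -> 'cV[R]_#|Lambda2 r|) (theta : R -> 'cV[R]_6) :=
    solves (KRtilde r rf rD rg rQ)
           (Ntilde ell r Gamma0) (Ntilde ell r Gamma0)
           (fun t => subvec (Lambda2 r) (forcing r rf Us Uf t))
           (Jmat Js) Dmat (Kmat Ks) (Tvec Ts)
           a b Psi theta in
  [/\ forall th : R,
        submat (Lambda1 r) (Lambda1 r) (Nmat ell Gamma0 th) \in unitmx,
      forall Psi theta, solves_O Psi theta ->
        solves_R (fun t => subvec (Lambda2 r) (Psi t)) theta
    & forall Psit theta, solves_R Psit theta ->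
        solves_O (fun t => Amat ell r Gamma0 (theta t fifth 0) *m Psit t)
                 theta].
Proof.
move=> solves_O solves_R.
have N11_unit th :
    submat (Lambda1 r) (Lambda1 r) (Nmat ell Gamma0 th) \in unitmx.
  exact: submat_Nmat_unit.
have EN11_unit th : select (Lambda1 r) *m (KL ell + Gamma Gamma0 th)
    *m (select (Lambda1 r))^T \in unitmx.
  by rewrite -submatE; exact: N11_unit.
have N_sym th : (KL ell + Gamma Gamma0 th)^T = KL ell + Gamma Gamma0 th.
  exact: trmx_Nmat.
have E22 := select_selectT (R := R) (Lambda2 r).
have E12 := select_selectCT (R := R) (Lambda1 r).
have E_1 := select_partition (R := R) (Lambda1 r).
have dG := derivable_Gamma (n := n) Gamma0.
have KE := KR_reduced r rf rD rg rQ.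
have f1 t := forcing_Lambda1 r rf Us Uf t r1_fin.
rewrite /solves_O /solves_R /Ntilde.
have AE : Amat ell r Gamma0 = fun th => schur_lift (select (Lambda1 r))
    (select (Lambda2 r)) (KL ell + Gamma Gamma0 th).
  by apply/funext => th; exact: AmatE.
have subE (g : R -> 'cV[R]_(ncoord n)) :
    (fun t => subvec (Lambda2 r) (g t)) = fun t => select (Lambda2 r) *m g t.
  by apply/funext => t; exact: subvecE.
rewrite AE (subE (forcing r rf Us Uf)); split=> [//|Psi theta|Psit theta].
  rewrite (subE Psi); exact: solves_reduce.
exact: solves_lift.
Qed.
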